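(* Let $X_{\mathrm{Tri}}$ denote the Tribonacci subshift. For all integers $\kappa\ge3$ and $\ell\ge2$, the subshift $X=\eta_{\kappa,\ell}^{-1}(X_{\mathrm{Tri}})\subseteq\mathcal A_\kappa^{\mathbb Z}$ is minimal.
   Context: $\mathbb N=\{1,2,\dots\}$, $\mathcal A_\kappa=\{0,\dots,\kappa-1\}$; $\mathcal A_\kappa^{\mathbb Z}$ carries the product topology and $\sigma(x)_n=x_{n+1}$ is the left shift. A subshift (closed $\sigma$-invariant subset) is minimal if all its $\sigma$-orbits are dense. The Tribonacci substitution is $\Gamma_{\mathrm{Tri}}:0\mapsto01,\ 1\mapsto02,\ 2\mapsto0$ (extended to words by concatenation). $X_{\mathrm{Tri}}$ is the set of all $x\in\{0,1,2\}^{\mathbb Z}$ such that every finite word occurring in $x$ is a subword of $\Gamma_{\mathrm{Tri}}^n(0)$ for some $n\in\mathbb N$; since $\{0,1,2\}\subseteq\mathcal A_\kappa$ for $\kappa\ge3$ it is regarded as a subshift of $\mathcal A_\kappa^{\mathbb Z}$. $\eta_{\kappa,\ell}:\mathcal A_\kappa^{\mathbb Z}\to\mathcal A_\kappa^{\mathbb Z}$ is the sliding block code $\eta_{\kappa,\ell}(x)_n=x_{n+\ell-1}-x_n\bmod\kappa$. *)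

(* Defs.v *)
From mathcomp Require Import all_boot all_order all_algebra.
From mathcomp Require Import all_classical topology.

Set Implicit Arguments.
Unset Strict Implicit.
Unset Printing Implicit Defensive.

Import Order.TTheory GRing.Theory Num.Theory.

Local Open Scope classical_set_scope.
Local Open Scope ring_scope.

(* The letters 0, ..., k - 1 are the elements of 'Z_k, so that subtraction of
   letters is subtraction mod k; this is meant for 1 < k only, since
   'Z_0 = 'Z_1 = 'Z_2. *)
Notation full_shift k := {ptws int -> discrete_topology 'Z_k}.

Definition shift_by (k : nat) (m : int) (x : full_shift k) : full_shift k :=
  fun n => x (n + m).

Definition shift (k : nat) : full_shift k -> full_shift k := shift_by 1.

Definition orbit (k : nat) (x : full_shift k) : set (full_shift k) :=
  [set shift_by m x | m in [set: int]].

Definition subshift (k : nat) (X : set (full_shift k)) : Prop :=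
  closed X /\ @shift k @` X = X.

(* Orbits of points of a subshift X stay in X, so density in X is
   [X `<=` closure _]. *)
Definition minimal_subshift (k : nat) (X : set (full_shift k)) : Prop :=
  subshift X /\ forall x, X x -> X `<=` closure (orbit x).

(* Words are sequences of natural numbers, so that {0, 1, 2} is a subset of
   every alphabet {0, ..., k - 1} with 3 <= k. Only the letters 0, 1, 2 matter
   here: the value at letters above 2 is junk. *)
Definition tribonacci_letter (a : nat) : seq nat :=
  match a with
  | 0 => [:: 0; 1]
  | 1 => [:: 0; 2]
  | _ => [:: 0]
  end%N.

Definition tribonacci (w : seq nat) : seq nat :=
  flatten (map tribonacci_letter w).

Definition factor_at (k : nat) (x : full_shift k) (i : int) (m : nat) :
    seq nat :=
  mkseq (fun j => nat_of_ord (x (i + j%:Z))) m.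

Definition X_Tri (k : nat) : set (full_shift k) :=
  [set x | (forall n : int, (nat_of_ord (x n) < 3)%N) /\
    forall (i : int) (m : nat),
      exists2 n : nat, (1 <= n)%N &
        infix (factor_at x i m) (iter n tribonacci [:: 0%N])].
Arguments X_Tri : clear implicits.

Definition eta (k l : nat) (x : full_shift k) : full_shift k :=
  fun n => (x (n + l%:Z - 1) : 'Z_k) - (x n : 'Z_k).
Arguments eta : clear implicits.

(* Main.v *)
Require Import Defs.
From mathcomp Require Import all_boot all_order all_algebra.
From mathcomp Require Import all_classical topology.
From mathcomp Require Import zify.

(** Write [d = l - 1]. A point [x] with [eta x = y] is a run of a shift register
    of [d] letters: the state at time [i] is the window [x_i ... x_(i+d-1)], and
    reading the letter [y_i] drops the first entry and appends
    [x_i + y_i = x_(i+d)]. Each letter thus acts as a permutation of the finite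
    set of states, and the letters 0 and 1 already act transitively. A factor of
    [x] is determined by a state and a factor of [y], so minimality follows once
    every run over a point of the Tribonacci subshift is shown to meet every
    pair (state, Tribonacci word).

    The heart of the proof ([visited_full]) concerns an arbitrary finite set on
    which the letters act transitively by permutations. Let [G] be the
    substitution and let the letter [a] act at level [n] as the word [G^n(a)].
    Fix a starting state and let [V_n] be the set of states met at level [n]
    along the fixed point 0102010... of [G]. Since [G] maps the fixed point to
    itself, [V_n] decreases with [n]; since every [G^3(b)] starts with 0102, a
    state of [V_(n+3)] can be moved by the level [n] actions of 0, 01 and 0102
    without leaving [V_n]. Hence if [V_(n+3) = V_n], this set is stable under
    the level [n] action of each letter, because a finite set stable under a
    permutation is also stable under its inverse. As [G] is invertible on the
    free group, stability descends from level [n + 1] to level [n]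
    ([stable_succ]), down to the letters themselves, and transitivity gives all
    states. If [V_(n+3)] is smaller than [V_n], induction on the size applies
    to [V_(n+3)].

    By finiteness one word [G^K(0)] leads from any state to any state at a
    boundary of level [n] blocks that is followed by [G^n(0)]
    ([uniform_visit]), and every long Tribonacci word contains [G^K(0)]
    ([tri_recurrence]). A given word [w] lies in some [G^n(0)]; aiming at the
    state that the part of [G^n(0)] before [w] transforms into the desired one
    finishes the argument. *)

Local Open Scope classical_set_scope.

Set Implicit Arguments.
Unset Strict Implicit.
Unset Printing Implicit Defensive.

Import Order.TTheory GRing.Theory Num.Theory.

(** * The Tribonacci substitution *)

Local Notation tri n w := (iter n tribonacci w).

Lemma tribonacci_cat u v : tribonacci (u ++ v) = tribonacci u ++ tribonacci v.
Proof. by rewrite /tribonacci map_cat flatten_cat. Qed.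

Lemma tri_cat n u v : tri n (u ++ v) = tri n u ++ tri n v.
Proof. by elim: n => //= n ->; rewrite tribonacci_cat. Qed.

Lemma tri_nil n : tri n [::] = [::].
Proof. by elim: n => //= n ->. Qed.

Lemma tribonacci_head b : exists r, tribonacci [:: b] = 0 :: r.
Proof. by case: b => [|[|b]]; eexists. Qed.

Lemma prefix_tri n u v : prefix u v -> prefix (tri n u) (tri n v).
Proof. by case/prefixP => w ->; rewrite tri_cat prefix_prefix. Qed.

Lemma prefix_tri_succ k b : prefix (tri k [:: 0]) (tri k.+1 [:: b]).
Proof.
have [r r_def] := tribonacci_head b.
by rewrite iterSr r_def -(cat1s 0 r) tri_cat prefix_prefix.
Qed.

Lemma prefix_tri_le j k :
  j <= k -> prefix (tri j [:: 0]) (tri k [:: 0]).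
Proof.
elim: k => [|k IHk]; first by rewrite leqn0 => /eqP ->.
rewrite leq_eqVlt => /orP[/eqP ->|/IHk jk]; first exact: prefix_refl.
exact: prefix_trans jk (prefix_tri_succ _ _).
Qed.

Lemma tri_letter_neq0 n b : tri n [:: b] != [::].
Proof.
case: n => [//|n]; apply/eqP => n0.
have := prefix_tri_succ n b; rewrite n0 prefixs0 => /eqP {}n0.
by have := prefix_tri_le (leq0n n); rewrite n0.
Qed.

(** The finite prefixes of the infinite word 0102010..., the fixed point of the
    substitution. *)
Definition initial (p : seq nat) := exists k, prefix p (tri k [:: 0]).

Lemma initial_prefix p q : prefix p q -> initial q -> initial p.
Proof. by move=> pq [k qk]; exists k; apply: prefix_trans qk. Qed.

Lemma initial_tri n p : initial p -> initial (tri n p).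
Proof. by case=> k pk; exists (n + k); rewrite iterD prefix_tri. Qed.

Lemma initial_rcons p : initial p -> exists b, initial (rcons p b).
Proof.
case=> k /prefixP[q pq].
have : tri k.+1 [:: 0] = p ++ q ++ tri k [:: 1].
  by rewrite iterSr catA -pq -tri_cat.
have : q ++ tri k [:: 1] != [::].
  by rewrite -size_eq0 size_cat addn_eq0 !size_eq0 (negPf (tri_letter_neq0 _ _)) andbF.
case: (q ++ _) => [//|b r] _ k1; exists b, k.+1.
by rewrite k1 -cat_rcons prefix_prefix.
Qed.

(** The exponent 3 is the least for which all images of letters agree long enough
    to display the first occurrence of each of the three letters. *)
Lemma prefix_tri3 b : prefix [:: 0; 1; 0; 2] (tri 3 [:: b]).
Proof. by case: b => [|[|b]]. Qed.

Lemma initial_tri3 p q :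
  initial p -> prefix q [:: 0; 1; 0; 2] -> initial (tri 3 p ++ q).
Proof.
case/initial_rcons => b pb q4; apply: initial_prefix (initial_tri 3 pb).
rewrite -cats1 tri_cat prefix_catr// eqxx.
exact: prefix_trans q4 (prefix_tri3 b).
Qed.

(** * Walks driven by Tribonacci words *)

Definition walk {T : Type} (f : nat -> T -> T) (w : seq nat) (s : T) : T :=
  foldl (fun s a => f a s) s w.

Lemma walk_cat (T : Type) (f : nat -> T -> T) u v s :
  walk f (u ++ v) s = walk f v (walk f u s).
Proof. exact: foldl_cat. Qed.

Lemma walk_inj (T : Type) (f : nat -> T -> T) w :
  (forall a, injective (f a)) -> injective (walk f w).
Proof. by move=> f_inj; elim: w => [|a w IHw] s t //= /IHw /f_inj. Qed.

(** On a finite set an injective self-map of [A] is onto [A]; this stands in for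
    applying the inverse permutation. *)
Lemma stable_preimage (T : finType) (g : T -> T) (A : {set T}) :
  injective g -> {in A, forall s, g s \in A} ->
  {in A, forall s, exists2 t, t \in A & s = g t}.
Proof.
move=> g_inj gA s sA; suff gAA : g @: A = A.
  by move: sA; rewrite -{1}gAA => /imsetP[t tA ->]; exists t.
apply/eqP; rewrite eqEcard card_imset// leqnn andbT.
by apply/fintype.subsetP => _ /imsetP[t tA ->]; apply: gA.
Qed.

Section Walks.
Variables (T : finType) (f : nat -> T -> T).
Hypothesis f_inj : forall a, injective (f a).

Definition stable (n : nat) (A : {set T}) :=
  forall a, a < 3 -> {in A, forall s, walk f (tri n [:: a]) s \in A}.

(** The substitution is invertible on the free group: 0 is the image of 2, and
    the letter [c + 1] is the image of [c], for [c = 0, 1], with the leading 0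
    cancelled. *)
Lemma stable_succ n A : stable n.+1 A -> stable n A.
Proof.
move=> stA.
have st0 : {in A, forall s, walk f (tri n [:: 0]) s \in A}.
  by move=> s sA; have := stA 2 isT s sA; rewrite iterSr.
have st c : c \in [:: 0; 1] ->
    {in A, forall s, walk f (tri n [:: c.+1]) s \in A}.
  move=> c01 s /(stable_preimage (@walk_inj _ f _ f_inj) st0)[t tA ->].
  rewrite -walk_cat -tri_cat.
  have -> : [:: 0] ++ [:: c.+1] = tribonacci [:: c].
    by move: c01; rewrite !inE => /orP[] /eqP ->.
  rewrite -iterSr; apply: stA => //.
  by move: c01; rewrite !inE => /orP[] /eqP ->.
by case=> [|[|[|//]]] _; [exact: st0|exact: st|exact: st].
Qed.

Hypothesis f_trans : forall A : {set T}, A != finset.set0 ->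
  (forall a, a < 3 -> {in A, forall s, f a s \in A}) -> A = [set: T]%SET.

Lemma stable_full n A : A != finset.set0 -> stable n A -> A = [set: T]%SET.
Proof.
move=> A0; elim: n => [|n IHn] stA; first exact: f_trans.
exact/IHn/stable_succ.
Qed.

Definition visited n s : {set T} :=
  finset (fun t => `[< exists2 p, initial p & walk f (tri n p) s = t >]).

Lemma visitedP n s t :
  reflect (exists2 p, initial p & walk f (tri n p) s = t) (t \in visited n s).
Proof. by rewrite inE; apply: asboolP. Qed.

(** Strong induction on the size of the visited set: either it shrinks three
    levels up, and the smaller set is already everything, or it does not, and
    then it is stable at level [n]. *)
Lemma visited_full n s : visited n s = [set: T]%SET.
Proof.
have [c] := ubnP #|visited n s|; elim: c n => // c IHc n /ltnSE le_c.
have sub : visited (n + 3) s \subset visited n s.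
  apply/fintype.subsetP => t /visitedP[p p_init <-]; apply/visitedP.
  by exists (tri 3 p); [exact: initial_tri|rewrite iterD].
have [eqV|neqV] := eqVneq (visited (n + 3) s) (visited n s); last first.
  have /IHc full : #|visited (n + 3) s| < c.
    by apply: leq_trans le_c; apply: proper_card; rewrite finset.properEneq neqV.
  by apply/eqP; rewrite -finset.subTset -full.
have stq q : prefix q [:: 0; 1; 0; 2] ->
    {in visited n s, forall t, walk f (tri n q) t \in visited n s}.
  move=> q4 t; rewrite -{1}eqV => /visitedP[p p_init <-]; apply/visitedP.
  exists (tri 3 p ++ q); first exact: initial_tri3.
  by rewrite tri_cat walk_cat iterD.
(* The action of the letter [a] is that of [q a] after undoing that of [q]. *)
have stqa q a : prefix (rcons q a) [:: 0; 1; 0; 2] ->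
    {in visited n s, forall t, walk f (tri n [:: a]) t \in visited n s}.
  move=> qa4 t; have q4 : prefix q [:: 0; 1; 0; 2].
    exact: prefix_trans (prefix_rcons _ _) qa4.
  case/(stable_preimage (@walk_inj _ f _ f_inj) (stq q q4)) => t' t'V ->.
  by rewrite -walk_cat -tri_cat cats1; apply: stq.
apply: (@stable_full n).
  apply/set0Pn; exists s; apply/visitedP; exists [::]; last by rewrite tri_nil.
  by exists 0.
by case=> [|[|[|//]]] _; [exact: (stqa [::])|exact: (stqa [:: 0])|
                          exact: (stqa [:: 0; 1; 0])].
Qed.

(** A bound [K] independent of the two states is what lets the word [G^K(0)] be
    located in a point first and the state at its start be read off afterwards.
    Visits are made at level [n + 1], because every level [n + 1] block
    starts with [G^n(0)]. *)
Lemma uniform_visit n :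
  exists K, forall s t, exists2 p,
    prefix (tri n.+1 p ++ tri n [:: 0]) (tri K [:: 0]) &
    walk f (tri n.+1 p) s = t.
Proof.
have /choice[K KP] (st : T * T) : exists k, exists2 p,
    prefix (tri n.+1 p ++ tri n [:: 0]) (tri k [:: 0]) &
    walk f (tri n.+1 p) st.1 = st.2.
  have /visitedP[p p_init pE] : st.2 \in visited n.+1 st.1.
    by rewrite visited_full inE.
  have [b /(initial_tri n.+1)[k pk]] := initial_rcons p_init.
  exists k, p => //; apply: prefix_trans pk.
  by rewrite -cats1 tri_cat prefix_catr// eqxx prefix_tri_succ.
exists (\max_st K st) => s t; have [p pK pE] := KP (s, t).
exists p => //; apply: prefix_trans pK _; apply: prefix_tri_le.
exact: leq_bigmax.
Qed.

End Walks.

(** * Recurrence *)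

Lemma size_tri n w : size (tri n w) <= 2 ^ n * size w.
Proof.
elim: n => [|n IHn]; first by rewrite expn0 mul1n.
have size_trib v : size (tribonacci v) <= 2 * size v.
  elim: v => // a v IHv; rewrite -cat1s tribonacci_cat !size_cat mulnDr.
  by apply: leq_add => //; case: a => [|[|]].
rewrite iterS (leq_trans (size_trib _))// expnS -mulnA.
by rewrite leq_mul2l.
Qed.

(** A word of twice the maximal length of a level [K + 1] block contains a whole
    such block, hence its prefix [G^K(0)]. *)
Lemma tri_recurrence K n u :
  infix u (tri n [:: 0]) -> 2 ^ K.+2 <= size u -> infix (tri K [:: 0]) u.
Proof.
(* Induction on [v] discards the blocks that lie entirely before [u]. *)
have blocks v p1 p2 : tri K.+1 v = p1 ++ u ++ p2 -> 2 ^ K.+2 <= size u ->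
    infix (tri K [:: 0]) u.
  move=> + u_long.
  have size_block b : size (tri K.+1 [:: b]) <= 2 ^ K.+1.
    by rewrite (leq_trans (size_tri _ _))// muln1.
  elim: v p1 => [|b v IHv] p1.
    rewrite tri_nil; case: p1 => //; case: u u_long => //.
    by rewrite leqn0 expn_eq0.
  rewrite -cat1s tri_cat.
  have [bp1|/ltnW p1b] := leqP (size (tri K.+1 [:: b])) (size p1).
    rewrite -(cat_take_drop (size (tri K.+1 [:: b])) p1) -catA.
    by move=> /eqP; rewrite eqseq_cat ?size_takel// => /andP[_ /eqP/IHv].
  rewrite -(cat_take_drop (size p1) (tri K.+1 [:: b])) -catA => /eqP.
  rewrite eqseq_cat ?size_takel// => /andP[_].
  (* [u] starts inside the first block, of which [b'] is the remaining part. *)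
  set b' := drop _ _; have b'_le : size b' <= 2 ^ K.+1.
    by rewrite (leq_trans _ (size_block b))// size_drop leq_subr.
  case: v {IHv} => [|c v].
    rewrite tri_nil cats0 => /eqP b'E; have := b'_le.
    rewrite b'E size_cat => /(leq_trans (leq_addr _ _)).
    move=> /(leq_trans u_long); rewrite leq_exp2l//.
    by rewrite ltnn.
  rewrite -cat1s tri_cat catA => /eqP bcE.
  have bc_le : size (b' ++ tri K.+1 [:: c]) <= size u.
    by rewrite (leq_trans _ u_long)// size_cat expnS mul2n -addnn leq_add.
  have : take (size (b' ++ tri K.+1 [:: c])) u = b' ++ tri K.+1 [:: c].
    by rewrite -(takel_cat p2 bc_le) -bcE take_size_cat.
  move=> uE; rewrite -(cat_take_drop (size (b' ++ tri K.+1 [:: c])) u) uE.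
  have /prefixP[r ->] := prefix_tri_succ K c.
  by apply/infixP; exists b', (r ++ drop (size (b' ++ tri K [:: 0] ++ r)) u); rewrite -!catA.
move=> u_inf u_long; have [p1 [p2 uE]] := infixP u_inf.
(* If [n] is too small, [G^n(0)] is shorter than [u]. *)
have [nK|Kn] := leqP n K.+1.
  have := leq_trans u_long (leq_trans (size_infix u_inf) (size_tri _ _)).
  by rewrite muln1 leq_exp2l// ltnNge nK.
apply: (blocks (tri (n - K.+1) [:: 0]) p1 p2) => //.
by rewrite -iterD subnKC// ltnW.
Qed.

(** * The shift register *)

Local Open Scope ring_scope.

Section Register.
Variables (k m : nat).
Implicit Types s t : m.+1.-tuple 'Z_k.

Definition feed (a : nat) s : m.+1.-tuple 'Z_k :=
  [tuple of rcons (behead s) (thead s + a%:R)].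

Lemma val_feed a s : val (feed a s) = rcons (behead s) (thead s + a%:R).
Proof. by []. Qed.

Lemma feed_inj a : injective (feed a).
Proof.
move=> s t /(congr1 val)/= /eqP.
rewrite eqseq_rcons => /andP[/eqP eq_behead /eqP/addIr eq_thead].
apply: val_inj.
by rewrite (tuple_eta s) (tuple_eta t)/= eq_thead eq_behead.
Qed.

(** Undoing [feed 0] and applying [feed 1] increments the last entry, so a stable
    set is stable under [feed c] for every [c]; feeding the differences with the
    entries of a target then replaces the entries one at a time. *)
Lemma feed_transitive (A : {set m.+1.-tuple 'Z_k}) : A != finset.set0 ->
  (forall a, (a < 3)%N -> {in A, forall s, feed a s \in A}) -> A = [set: _]%SET.
Proof.
move=> /set0Pn[s0 s0A] stA.
have feedA c : {in A, forall s, feed c s \in A}.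
  elim: c => [|c IHc] s sA; first exact: stA.
  have [t tA] := stable_preimage (@feed_inj 0) (stA 0%N isT) (IHc s sA).
  move=> /(congr1 val)/= /eqP.
  rewrite eqseq_rcons => /andP[/eqP eq_behead /eqP eq_thead].
  suff -> : feed c.+1 s = feed 1 t by exact: stA.
  apply: val_inj; rewrite /= eq_behead; congr rcons.
  by rewrite -natr1 addrA eq_thead addr0.
have reach u : forall v w s, s \in A -> val s = u ++ v -> size w = size u ->
    exists2 t, t \in A & val t = v ++ w.
  elim: u => [|a u IHu] v [|b w] s sA sE //.
    by exists s => //; rewrite cats0.
  move=> [size_w]; rewrite -cat_rcons.
  apply: (IHu _ _ (feed (nat_of_ord (b - a : 'Z_k)) s)) => //.
    exact: feedA.
  rewrite val_feed natr_Zp sE /= -rcons_cat; congr rcons.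
  have -> : thead s = a by rewrite (tuple_eta s) in sE; case: sE.
  by rewrite addrC subrK.
apply/eqP; rewrite -finset.subTset; apply/fintype.subsetP => t _.
have [|//|t' t'A /val_inj <- //] := reach s0 [::] t s0 s0A.
  by rewrite cats0.
by rewrite !size_tuple.
Qed.

End Register.

(** * Runs over the Tribonacci subshift *)

Section Windows.
Variable k : nat.
Implicit Types x y z : full_shift k.

Lemma factor_atD x i n1 n2 :
  factor_at x i (n1 + n2) = factor_at x i n1 ++ factor_at x (i + n1%:Z) n2.
Proof.
rewrite /factor_at /mkseq iotaD map_cat add0n; congr (_ ++ _).
rewrite -[in LHS](addn0 n1) iotaDl -map_comp.
by apply: eq_map => j /=; rewrite PoszD addrA.
Qed.

Lemma size_factor_at x i n : size (factor_at x i n) = n.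
Proof. exact: size_mkseq. Qed.

Lemma factor_at_cat x i n u v : factor_at x i n = u ++ v ->
  factor_at x i (size u) = u /\ factor_at x (i + (size u)%:Z) (size v) = v.
Proof.
move=> xuv; have nE : n = (size u + size v)%N.
  by rewrite -(size_factor_at x i n) xuv size_cat.
move: xuv; rewrite nE factor_atD => /eqP.
by rewrite eqseq_cat ?size_factor_at// => /andP[/eqP ? /eqP].
Qed.

Lemma factor_at_infix x i n u : infix u (factor_at x i n) ->
  exists j, factor_at x j (size u) = u.
Proof.
case/infixP => p1 [p2] /factor_at_cat[_ /factor_at_cat[xu _]].
by eexists; exact: xu.
Qed.

Lemma factor_at_eqP x z i j n :
  (forall r, (r < n)%N -> x (i + r%:Z) = z (j + r%:Z)) <->
  factor_at x i n = factor_at z j n.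
Proof.
split=> [xz|xz r rn].
  by apply/eq_in_map => r; rewrite mem_iota => rn; rewrite xz.
apply: ord_inj; move/(congr1 (nth 0%N ^~ r)): xz.
by rewrite !nth_mkseq.
Qed.

Lemma factor_at_shift_by x a i n :
  factor_at (shift_by a x) i n = factor_at x (i + a) n.
Proof. by apply: eq_map => j; rewrite /shift_by addrAC. Qed.

Lemma eta_shift_by l a x : eta k l (shift_by a x) = shift_by a (eta k l x).
Proof.
apply/funext => n; rewrite /eta /shift_by.
by have -> : n + l%:Z - 1 + a = n + a + l%:Z - 1 by lia.
Qed.

Lemma shift_by0 x : shift_by 0 x = x.
Proof. by apply/funext => n; rewrite /shift_by addr0. Qed.

Lemma shift_byD a b x : shift_by a (shift_by b x) = shift_by (a + b) x.
Proof. by apply/funext => n; rewrite /shift_by addrA. Qed.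

Lemma X_Tri_shift_by a x : X_Tri k x -> X_Tri k (shift_by a x).
Proof.
move=> [x3 xinf]; split=> [n|i n]; first exact: x3.
by rewrite factor_at_shift_by; apply: xinf.
Qed.

Variable m : nat.

Definition window x (i : int) : m.+1.-tuple 'Z_k :=
  [tuple x (i + j%:Z) | j < m.+1].

Lemma nth_window x i j : (j < m.+1)%N -> nth 0 (window x i) j = x (i + j%:Z).
Proof. by move=> jm; rewrite -(tnth_nth _ _ (Ordinal jm)) tnth_mktuple. Qed.

Lemma thead_window x i : thead (window x i) = x i.
Proof. by rewrite /thead tnth_mktuple addr0. Qed.

Lemma eta_window x i : (eta k m.+2 x i : 'Z_k) = x (i + m.+1%:Z) - x i :> 'Z_k.
Proof. by rewrite /eta -addrA. Qed.

Lemma window_succ x i :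
  window x (i + 1) = feed (nat_of_ord (eta k m.+2 x i)) (window x i).
Proof.
apply: val_inj; rewrite val_feed natr_Zp.
rewrite thead_window eta_window subrKC.
apply: (@eq_from_nth _ 0); first by rewrite size_rcons size_behead !size_tuple.
move=> j; rewrite size_tuple => jm; rewrite nth_window// nth_rcons size_behead.
rewrite size_tuple nth_behead -addrA -PoszD add1n.
case: ltngtP => [jm'|/leq_trans/(_ jm)|->//]; last by rewrite ltnn.
by rewrite nth_window.
Qed.

Lemma walk_window x i n :
  walk (@feed k m) (factor_at (eta k m.+2 x) i n) (window x i) =
  window x (i + n%:Z).
Proof.
elim: n => [|n IHn]; first by rewrite addr0.
by rewrite -(addn1 n) factor_atD walk_cat IHn PoszD addrA window_succ /= addr0.
Qed.

Lemma factor_at_window x z i j n : window x i = window z j ->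
  factor_at (eta k m.+2 x) i n = factor_at (eta k m.+2 z) j n ->
  factor_at x i n = factor_at z j n.
Proof.
move=> wxz yxz; apply/factor_at_eqP => r rn.
have : factor_at (eta k m.+2 x) i r = factor_at (eta k m.+2 z) j r.
  by apply/factor_at_eqP => q qr; move/factor_at_eqP: yxz; apply; apply: ltn_trans rn.
move=> yxz_r; have := walk_window x i r.
rewrite yxz_r wxz walk_window => /(congr1 (@thead _ _)).
by rewrite !thead_window.
Qed.

Lemma X_Tri_recurrent y K : X_Tri k y ->
  exists i, factor_at y i (size (tri K [:: 0%N])) = tri K [:: 0%N].
Proof.
move=> [_ /(_ 0 (2 ^ K.+2)%N)[n _ /(@tri_recurrence K)]].
by rewrite size_factor_at leqnn => /(_ isT)/factor_at_infix.
Qed.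

(** Let [w] be the factor of [eta z] at [i], and [G^N(0) = p1 w p2]. The word
    [G^K(0)] occurs in [eta x], say at [i0], and contains [G^(N+1)(p) p1 w] for a
    [p] such that the state reached after [G^(N+1)(p)] is the one that [p1]
    transforms into the state of [z] at [i]. After [p1], the point [x] has the
    state of [z] and reads the same word. *)
Lemma eta_X_Tri_transitive x z i n :
  X_Tri k (eta k m.+2 x) -> X_Tri k (eta k m.+2 z) ->
  exists j, factor_at x j n = factor_at z i n.
Proof.
move=> Tx [_ /(_ i n)[N _ /infixP[p1 [p2 zE]]]].
have [K KP] := uniform_visit (@feed_inj k m) (@feed_transitive k m) N.
have [i0 xK] := X_Tri_recurrent K Tx.
have [s0 s0E] : exists s0, window z i = walk (@feed k m) p1 s0.
  have /injF_onto/(_ (window z i))/codomP := walk_inj (w := p1) (@feed_inj k m).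
  exact.
have [p /prefixP[p3]] := KP (window x i0) s0.
rewrite -catA zE -!catA => KE pE; rewrite KE in xK.
have {xK} := factor_at_cat xK.
set i1 := i0 + _ => -[xp].
move=> /factor_at_cat; set i2 := i1 + _ => -[xp1] /factor_at_cat[xz _].
exists i2; apply: factor_at_window; last first.
  by rewrite size_factor_at in xz.
have -> : window x i2 = walk (@feed k m) p1 (window x i1).
  by rewrite -{1}xp1 walk_window.
have -> : window x i1 = s0 by rewrite -pE -{1}xp walk_window.
by rewrite s0E.
Qed.

End Windows.

(** * Cylinders *)

Section Cylinders.
Variable k : nat.
Implicit Types x y z : full_shift k.

Lemma nbhs_coordinate x (i : int) : nbhs x [set z : full_shift k | z i = x i].
Proof.
apply: (@proj_continuous _ (fun=> discrete_topology 'Z_k) i x [set x i]).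
exact: discrete_set1.
Qed.

Lemma nbhs_factor_at x i n :
  nbhs x [set z : full_shift k | factor_at z i n = factor_at x i n].
Proof.
elim: n => [|n IHn]; first exact: filterE.
apply: filterS2 IHn (nbhs_coordinate x (i + n%:Z)) => z /= zn zi.
rewrite -addn1 !factor_atD zn; congr (_ ++ _).
by apply/factor_at_eqP => -[] // _; rewrite addr0.
Qed.

(** The cylinders over centred windows form a filter base whose filter converges
    to [x] pointwise, hence is finer than the neighbourhood filter. *)
Lemma nbhs_has_factor_at x (B : set (full_shift k)) : nbhs x B ->
  exists i n, [set z : full_shift k | factor_at z i n = factor_at x i n] `<=` B.
Proof.
move=> xB.
pose c (n : nat) := [set z : full_shift k |
  factor_at z (- n%:Z) (n + n).+1 = factor_at x (- n%:Z) (n + n).+1].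
pose F := filter_from [set: nat] c.
have c_coord n z (t : int) : c n z -> (`|t| <= n)%N -> z t = x t.
  move=> /factor_at_eqP zx tn.
  have := zx `|(t + n%:Z)%R|%N.
  have -> : - n%:Z + (`|(t + n%:Z)%R|%N)%:Z = t :> int by lia.
  by apply; lia.
have F_filter : Filter F.
  apply: filter_from_filter; first by exists 0%N.
  move=> n1 n2 _ _; exists (maxn n1 n2) => // z zc; split;
    apply/factor_at_eqP => r rn; apply: (c_coord _ _ _ zc); lia.
have /(_ B xB)[n _ nB] : F --> x; last by exists (- n%:Z), (n + n).+1.
(* The criterion wants a topology on the index set; any choice serves. *)
apply/(@pointwise_cvgP (discrete_topology int) (discrete_topology 'Z_k)) => t U /= xU.
exists `|t|%N => // z zc /=.
rewrite (c_coord _ _ _ zc)//; exact: nbhs_singleton.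
Qed.

End Cylinders.

Theorem theorem4p6 (kappa l : nat) (hkappa : (3 <= kappa)%N) (hl : (2 <= l)%N) :
  minimal_subshift (eta kappa l @^-1` X_Tri kappa).
Proof.
case: l hl => [|[|m]] // _; split; last first.
  move=> x Tx z Tz B /nbhs_has_factor_at[i [n nB]].
  have [j xz] := eta_X_Tri_transitive i n Tx Tz.
  exists (shift_by (j - i) x); split; first by exists (j - i).
  by apply: nB => /=; rewrite factor_at_shift_by addrC subrK.
split.
  move=> x clx.
  have etax i n : exists2 z, X_Tri kappa (eta kappa m.+2 z) &
      factor_at (eta kappa m.+2 x) i n = factor_at (eta kappa m.+2 z) i n.
    have [z [Tz /factor_at_eqP zx]] := clx _ (nbhs_factor_at x i (n + m.+1)).
    exists z => //; apply/factor_at_eqP => r rn; rewrite !eta_window.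
    by rewrite -addrA -PoszD !zx// ?ltn_add2r// ltn_addr.
  split=> [n|i n]; last by have [z [_ Tz] ->] := etax i n; exact: Tz.
  have [z [z3 _]] := etax n 1%N.
  by move=> /factor_at_eqP/(_ 0%N isT); rewrite !addr0 => ->.
apply/seteqP; split=> [_ [x Tx <-]|x Tx] /=.
  by rewrite /shift eta_shift_by; exact: X_Tri_shift_by.
exists (shift_by (-1) x); first by rewrite /= eta_shift_by; exact: X_Tri_shift_by.
by rewrite /shift shift_byD subrr shift_by0.
Qed.
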